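(* There is a function $p^{\geqslant}_\lambda(r,\ell,m)$ with values in $[0,\infty)$, given by a closed-form formula in the parameters and defined for all real $0<\lambda\leqslant 1/6$ and all integers $r\geqslant 2$, $\ell\geqslant 1$, $m\geqslant 1$, such that the following hold. (i) If a presentation is chosen uniformly at random from the set of all presentations of the form $\langle X\mid W\rangle$ where $|X|=r$, $|W|=m$ and $|w|=\ell$ for all $w\in W$, then it is power-free and satisfies the metric small cancellation condition $C'(\lambda)$ with probability at most $p^{\geqslant}_\lambda(r,\ell,m)$. (ii) For each $m\geqslant 1$ and $r\geqslant 2$, $$\ln\bigl(1/p^{\geqslant}_\lambda(r,\ell,m)\bigr)\geqslant \frac18 (m-1)^2\,\ell\,(2r-1)^{-\lceil\lambda\ell\rceil}.$$ (iii) For each fixed $r\geqslant 2$, $\lambda$ and $m$, $\lim_{\ell\to\infty}p^{\geqslant}_\lambda(r,\ell,m)=1$, and thus $\lim_{\ell\to\infty}\ln(1/p^{\geqslant}_\lambda(r,\ell,m))=0$.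
   Context: Let $X$ be a fixed set with $r$ elements and $F(X)$ the free group on $X$, whose elements are identified with freely reduced words over $X^{\pm1}$; $|w|$ denotes word length. A word is cyclically reduced if all its cyclic permutations are freely reduced. For $0\leqslant d<|w|$, $w_{\ll d}$ denotes the left cyclic permutation of $w$ by distance $d$ (the first $d$ letters are moved to the end). A presentation $\langle X\mid W\rangle$ with $r$ generators and $m=|W|$ relators is given by an ordered list $W\in F(X)^m$ of cyclically reduced words; repetitions are allowed, and lists differing by a permutation are considered distinct. ''Chosen uniformly at random'' refers to the uniform distribution on such lists for fixed $X$. The symmetric closure of a list $W$ is $W^S=\{w_{\ll d},(w_{\ll d})^{-1} : w\in W,\ 0\leqslant d<|w|\}$. The list $W$ is minimal if there is no proper sublist $U$ with $U^S=W^S$. A cyclically reduced word $w$ is power-free if $|(w)^S|=2|w|$ (equivalently, it is not a proper power); a presentation is power-free if all its relators are. The presentation $\langle X\mid W\rangle$ has metric small cancellation $C'(\lambda)$ if $W$ is minimal, each $w\in W$ is power-free, and for any two distinct words $u,w\in W^S$: if $u=pa$ and $w=pb$ with $p,a,b\in F(X)$, $|u|=|p|+|a|$ and $|w|=|p|+|b|$, then $|p|<\lambda\cdot\min(|u|,|w|)$. A closed-form formula means an explicit expression in $\lambda,r,\ell,m$ built from arithmetic operations, powers, rounding, minima, case distinctions, and finite sums and products. Convention: $\ln(1/0)=+\infty$. *)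

(* Defs.v *)
From HB Require Import structures.
From mathcomp Require Import all_boot all_order all_algebra.
From mathcomp Require Import all_classical all_reals all_analysis.

Set Implicit Arguments.
Unset Strict Implicit.
Unset Printing Implicit Defensive.

Import Order.TTheory GRing.Theory Num.Theory.
Import numFieldNormedType.Exports.

Local Open Scope ring_scope.

Section FreeGroup.
Variable X : finType.

(* (x, true) is the generator x and (x, false) is its inverse. *)
Definition letter : Type := (X * bool)%type.
HB.instance Definition _ := Finite.on letter.

Definition linv (a : letter) : letter := (a.1, ~~ a.2).

Definition reduced (w : seq letter) : bool :=
  sorted (fun a b => b != linv a) w.

Definition push (a : letter) (s : seq letter) : seq letter :=
  if s is b :: s' then if b == linv a then s' else a :: s else [:: a].

Definition reduce (w : seq letter) : seq letter := foldr push [::] w.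

Lemma linvK : involutive linv.
Proof. by case=> x b; rewrite /linv /= negbK. Qed.

Lemma push_reduced a s : reduced s -> reduced (push a s).
Proof.
case: s => [|b s] //= bs; case: ifP => [_|/negbT ab] /=; last by rewrite ab.
exact: path_sorted bs.
Qed.

Lemma foldr_push_reduced s w : reduced s -> reduced (foldr push s w).
Proof. by move=> rs; elim: w => //= a w; exact: push_reduced. Qed.

Lemma reduce_reduced w : reduced (reduce w).
Proof. exact: foldr_push_reduced. Qed.

Lemma reduce_id w : reduced w -> reduce w = w.
Proof.
elim: w => //= a w IHw aw; rewrite IHw; last exact: path_sorted aw.
by case: w aw {IHw} => //= b w /andP[/negbTE-> _].
Qed.

Lemma push_linv a s : reduced s -> push a (push (linv a) s) = s.
Proof.
case: s => [|b s] /=; first by rewrite eqxx.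
rewrite linvK; case: eqVneq => [-> {b}|ba bs] /=; last by rewrite eqxx.
by case: s => //= c s /andP[/negbTE-> _].
Qed.

Lemma foldr_push_push s a w : reduced s ->
  foldr push s (push a w) = push a (foldr push s w).
Proof.
move=> rs; case: w => [|b w] //=; case: eqP => //= ->.
by rewrite push_linv // foldr_push_reduced.
Qed.

Lemma foldr_push_reduce s w : reduced s ->
  foldr push s (reduce w) = foldr push s w.
Proof. by move=> rs; elim: w => //= a w <-; rewrite foldr_push_push. Qed.

Record free_group : Type :=
  FreeGroup { fg_word :> seq letter; _ : reduced fg_word }.
HB.instance Definition _ := [isSub for fg_word].
HB.instance Definition _ := [Choice of free_group by <:].

Definition fg_of_word (w : seq letter) : free_group :=
  FreeGroup (reduce_reduced w).
Definition fg_mul (u v : free_group) : free_group := fg_of_word (u ++ v).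
Definition fg_inv (u : free_group) : free_group :=
  fg_of_word (rev (map linv u)).
Definition fg_one : free_group := fg_of_word [::].

Lemma fg_mulE (u v : free_group) : fg_word (fg_mul u v) = foldr push v u.
Proof. by rewrite /= /reduce foldr_cat -/(reduce v) reduce_id //; case: v. Qed.

Lemma fg_mulA : associative fg_mul.
Proof.
move=> u v w; apply: (val_inj : injective fg_word); rewrite !fg_mulE.
by rewrite -[foldr push v u]fg_mulE foldr_push_reduce ?foldr_cat //; case: w.
Qed.

Lemma fg_mul1 : left_id fg_one fg_mul.
Proof. by case=> w rw; apply: val_inj; rewrite /= reduce_id. Qed.

Lemma fg_mulg1 : right_id fg_one fg_mul.
Proof. by case=> w rw; apply: val_inj; rewrite /= cats0 reduce_id. Qed.

Lemma fg_mulgV : right_inverse fg_one fg_inv fg_mul.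
Proof.
move=> u; apply: (val_inj : injective fg_word); rewrite fg_mulE.
case: u => w /= _.
elim/last_ind: w => //= w a IHw; rewrite map_rcons rev_rcons -cats1 foldr_cat /=.
by rewrite push_linv // reduce_reduced.
Qed.

Lemma fg_mulVg : left_inverse fg_one fg_inv fg_mul.
Proof.
move=> u; have uv := fg_mulgV (fg_inv u).
have uVV : fg_inv (fg_inv u) = u.
  by rewrite -[RHS]fg_mulg1 -uv fg_mulA fg_mulgV fg_mul1.
by rewrite uVV in uv.
Qed.

HB.instance Definition _ :=
  isGroup.Build free_group fg_mulA fg_mul1 fg_mulg1 fg_mulVg fg_mulgV.

Definition cyclically_reduced (w : seq letter) : bool :=
  all (fun d => reduced (rot d w)) (iota 0 (size w)).

Lemma cyclically_reduced_reduced w : cyclically_reduced w -> reduced w.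
Proof. by case: w => //= a w /andP[]; rewrite rot0. Qed.

(* For w cyclically reduced, rot d w is reduced and fg_of_word leaves it
   unchanged (reduce_id). *)
Definition cyclic_shift (d : nat) (w : free_group) : free_group :=
  fg_of_word (rot d w).

Definition symmetric_closure (W : seq free_group) : seq free_group :=
  flatten [seq flatten [seq [:: cyclic_shift d w; (cyclic_shift d w)^-1%g]
                       | d <- iota 0 (size w)] | w : free_group <- W].

Definition minimal (W : seq free_group) : Prop :=
  forall U, subseq U W -> U <> W ->
    ~ (symmetric_closure U =i symmetric_closure W).

Definition power_free (w : free_group) : Prop :=
  size (undup (symmetric_closure [:: w])) = (2 * size w)%N.

Definition metric_small_cancellation (R : realType) (lam : R)
    (W : seq free_group) : Prop :=
  [/\ minimal W,
      forall w, w \in W -> power_free w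
    & forall u w, u \in symmetric_closure W -> w \in symmetric_closure W ->
        u <> w ->
      forall p a b : free_group, u = (p * a)%g -> w = (p * b)%g ->
        size u = (size p + size a)%N -> size w = (size p + size b)%N ->
        (size p)%:R < lam * (minn (size u) (size w))%:R].

Definition cr_word (l : nat) : Type :=
  {w : l.-tuple letter | cyclically_reduced w}.
HB.instance Definition _ l := Finite.on (cr_word l).

Definition relator l (w : cr_word l) : free_group :=
  FreeGroup (cyclically_reduced_reduced (valP w)).

End FreeGroup.

Definition uniform_pr (R : realType) (T : finType) (A : T -> Prop) : R :=
  #|[pred t | `[< A t >]]|%:R / #|T|%:R.

Definition pr_small_cancellation (R : realType) (X : finType) (lam : R)
    (l m : nat) : R :=
  uniform_pr R (fun W : m.-tuple (cr_word X l) =>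
    let rels := [seq relator w | w <- W] in
    (forall w, w \in rels -> power_free w)
    /\ metric_small_cancellation lam rels).

(* Explicit expressions in the parameters lambda, r, l, m.  Summation and
   product indices are de Bruijn indices: F_idx 0 is the innermost one. *)
Inductive formula : Type :=
| F_lambda | F_r | F_l | F_m
| F_idx of nat
| F_int of int
| F_add of formula & formula
| F_sub of formula & formula
| F_mul of formula & formula
| F_div of formula & formula
| F_pow of formula & formula
| F_floor of formula
| F_ceil of formula
| F_min of formula & formula
| F_if_le of formula & formula & formula & formula
| F_sum of formula & formula & formula
| F_prod of formula & formula & formula.

Section Semantics.
Variables (R : realType) (lam : R) (r l m : nat).

(* powR is only meaningful for a nonnegative base, so that integer exponents,
   as in (-1)^l, are treated separately. *)
Definition real_pow (a b : R) : R :=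
  if b \is a Num.int then a ^ Num.floor b else a `^ b.

Definition real_pow_defined (a b : R) : bool :=
  [|| 0 < a, (a == 0) && (0 <= b) | (a != 0) && (b \is a Num.int)].

(* Number of integers k with a <= k <= b, for integers a and b. *)
Definition range_size (a b : R) : nat := Num.truncn (b - a + 1).

(* s lists the values of the bound indices, innermost first;
   F_sum A B G is the sum of G for k = A, A + 1, ..., B. *)
Fixpoint feval (s : seq R) (F : formula) : R :=
  match F with
  | F_lambda => lam
  | F_r => r%:R
  | F_l => l%:R
  | F_m => m%:R
  | F_idx i => s`_i
  | F_int z => z%:~R
  | F_add A B => feval s A + feval s B
  | F_sub A B => feval s A - feval s B
  | F_mul A B => feval s A * feval s B
  | F_div A B => feval s A / feval s B
  | F_pow A B => real_pow (feval s A) (feval s B)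
  | F_floor A => (Num.floor (feval s A))%:~R
  | F_ceil A => (Num.ceil (feval s A))%:~R
  | F_min A B => Num.min (feval s A) (feval s B)
  | F_if_le A B G H =>
      if feval s A <= feval s B then feval s G else feval s H
  | F_sum A B G => \sum_(k < range_size (feval s A) (feval s B))
                     feval (feval s A + k%:R :: s) G
  | F_prod A B G => \prod_(k < range_size (feval s A) (feval s B))
                      feval (feval s A + k%:R :: s) G
  end.

(* Excludes the values that feval takes only by totality of the operations
   (division by zero, meaningless powers, unbound indices, non-integral
   ranges); only the selected branch of a case distinction must be defined. *)
Fixpoint fdefined (s : seq R) (F : formula) : Prop :=
  match F with
  | F_lambda | F_r | F_l | F_m | F_int _ => True
  | F_idx i => (i < size s)%N
  | F_add A B | F_sub A B | F_mul A B | F_min A B =>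
      fdefined s A /\ fdefined s B
  | F_div A B => [/\ fdefined s A, fdefined s B & feval s B != 0]
  | F_pow A B => [/\ fdefined s A, fdefined s B
                   & real_pow_defined (feval s A) (feval s B)]
  | F_floor A | F_ceil A => fdefined s A
  | F_if_le A B G H =>
      [/\ fdefined s A, fdefined s B
        & if feval s A <= feval s B then fdefined s G else fdefined s H]
  | F_sum A B G | F_prod A B G =>
      [/\ fdefined s A /\ fdefined s B,
          feval s A \is a Num.int, feval s B \is a Num.int
        & forall k, (k < range_size (feval s A) (feval s B))%N ->
            fdefined (feval s A + k%:R :: s) G]
  end.

Definition admissible : Prop :=
  [/\ 0 < lam <= 1 / 6, (2 <= r)%N, (1 <= l)%N & (1 <= m)%N].

End Semantics.

Definition closed_form (R : realType) (p : R -> nat -> nat -> nat -> R) : Prop :=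
  exists F : formula, forall (lam : R) (r l m : nat), admissible lam r l m ->
    fdefined lam r l m [::] F /\ p lam r l m = feval lam r l m [::] F.

(* Main.v *)
Require Import Defs.
From mathcomp Require Import all_boot all_order all_algebra.
From mathcomp Require Import all_classical all_reals all_analysis.
From mathcomp Require Import ring lra zify.

Import Order.TTheory GRing.Theory Num.Theory.
Import numFieldNormedType.Exports.

Local Open Scope classical_set_scope.
Local Open Scope ring_scope.

(* Let k = ceil(lambda l).  Under the small cancellation condition the 2lm
   elements of the symmetric closure are pairwise distinct and no two of them
   share a prefix of length k.  Hence, if the relators are drawn one by one, the
   prefix of length k of a new relator avoids the 2li distinct prefixes produced
   by the i relators already drawn.  A cyclically reduced word starts with a
   given reduced word of length k with probability at least
   (2r-1)^{-k} / 2, so the probability in question is at most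
     prod_{i<m} (1 - min 1 (i x)),  where x = l (2r-1)^{-k}.
   This product lies between 1 - m^2 x and exp(- m (m-1) x / 2), and x tends to
   0 as l grows. *)

(** * Estimates for the product and for its extended logarithm *)

Definition piece_bound {R : realType} (m : nat) (x : R) : R :=
  \prod_(i < m) (1 - Num.min 1 (i%:R * x)).

(** The truncation by [Num.min 1] matters here: a factor with i x > 1 becomes 0 instead of
    negative. *)
Lemma piece_bound_ge0 {R : realType} m (x : R) : 0 <= piece_bound m x.
Proof. by apply: prodr_ge0 => i _; rewrite subr_ge0 ge_min lexx. Qed.

Lemma piece_bound_le1 {R : realType} m (x : R) :
  0 <= x -> piece_bound m x <= 1.
Proof.
move=> x0; apply: prodr_ile1 => i _; rewrite subr_ge0 ge_min lexx /=.
by rewrite gerBl le_min ler01 mulr_ge0.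
Qed.

Lemma piece_boundS {R : realType} m (x : R) :
  piece_bound m.+1 x = piece_bound m x * (1 - Num.min 1 (m%:R * x)).
Proof. exact: big_ord_recr. Qed.

(** As the partial products are at most 1, a new factor 1 - y lowers the product by at most y <= i
    x. The losses add up to at most the sum of i x over i < m, for which m^2 x is a crude bound. *)
Lemma piece_bound_ge {R : realType} m (x : R) :
  0 <= x -> 1 - m%:R ^+ 2 * x <= piece_bound m x.
Proof.
move=> x0; elim: m => [|m]; first by rewrite /piece_bound big_ord0; lra.
rewrite piece_boundS.
have m0 : 0 <= m%:R :> R by [].
move: (piece_bound_ge0 m x) (piece_bound_le1 m x x0).
have y0 : 0 <= Num.min 1 (m%:R * x) by rewrite le_min ler01 mulr_ge0.
have ym : Num.min 1 (m%:R * x) <= m%:R * x by rewrite ge_min lexx orbT.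
have mx0 : 0 <= m%:R * x by rewrite mulr_ge0.
rewrite -natr1; set y := Num.min _ _ in y0 ym *; set P := piece_bound _ _.
move=> P0 P1 IHP; have : P * y <= y by rewrite ler_piMl.
move: IHP; rewrite -/P; move: (m%:R) m0 mx0 ym => a; nra.
Qed.

(** Each factor is at most exp(- i x): it is either 0 or 1 - i x. The exponents sum to m (m - 1) x /
    2. *)
Lemma piece_bound_le_expR {R : realType} m (x : R) : 0 <= x ->
  piece_bound m x <= expR (- (1 / 2 * (m%:R * (m%:R - 1)) * x)).
Proof.
move=> x0; elim: m => [|m IHm].
  by rewrite /piece_bound big_ord0 mul0r mulr0 mul0r oppr0 expR0.
have -> : - (1 / 2 * (m.+1%:R * (m.+1%:R - 1)) * x) =
    - (1 / 2 * (m%:R * (m%:R - 1)) * x) + - (m%:R * x) :> R.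
  by rewrite -[m.+1%:R]natr1; move: (m%:R) => a; field.
rewrite piece_boundS expRD ler_pM ?piece_bound_ge0 //.
  by rewrite subr_ge0 ge_min lexx.
rewrite lerBlDr -lerBlDl le_min; apply/andP; split.
  by rewrite gerBl expR_ge0.
by have := expR_ge1Dx (- (m%:R * x)); lra.
Qed.

Lemma lne_inve_ge {R : realType} (y s : R) :
  0 <= y -> y <= expR (- s) -> (s%:E <= lne (y%:E^-1))%E.
Proof.
move=> y0 ys; rewrite inver; case: eqVneq => [//|yN0]; first by rewrite leey.
have y_gt0 : 0 < y by rewrite lt_neqAle eq_sym yN0.
rewrite lne_EFin ?invr_gt0 // lnV ?posrE // lee_fin lerNr.
by rewrite -ler_expR lnK ?posrE.
Qed.

Lemma cvg_lne_inve {R : realType} (u : nat -> R) :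
  u @ \oo --> (1 : R) -> (fun n => lne ((u n)%:E^-1)%E) @ \oo --> 0%E.
Proof.
move=> u1.
have lnu : (fun n => - ln (u n)) @ \oo --> (0 : R).
  rewrite -[0 in X in _ --> X]oppr0 -(@ln1 R); apply: cvgN.
  exact: (cvg_comp _ _ u1 (continuous_ln ltr01)).
have lneu : (fun n => (- ln (u n))%:E) @ \oo --> 0%E.
  by apply: cvg_EFin lnu; exact: nearW.
apply: cvg_trans lneu; apply: near_eq_cvg.
(* Eventually the sequence is positive, and there the extended logarithm of the inverse is the real
   number - ln (u n). *)
have : \forall n \near \oo, 0 < u n by apply: (cvgr_gt _ u1).
apply: filterS => n un0; rewrite inver gt_eqF // lne_EFin ?invr_gt0 //.
by rewrite lnV.
Qed.

(** * Decay of l b^(-k) for k the ceiling of lambda l *)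

Lemma sqr_le_exp3 k : (k ^ 2 <= 3 ^ k)%N.
Proof.
elim: k => [//|[|[|k]] IHk] //; rewrite [leqRHS]expnS.
by rewrite -!mulnn in IHk *; move: (3 ^ _)%N IHk => z; nia.
Qed.

(** With k the ceiling, (lambda l)^2 <= k^2 <= 3^k <= b^k, so the term is at most 1 / (lambda^2
    l). *)
Lemma cvg_mul_expr_ceil {R : realType} (lam b : R) : 0 < lam -> 3 <= b ->
  (fun l : nat => l%:R * b ^ (- Num.ceil (lam * l%:R))) @ \oo --> (0 : R).
Proof.
move=> lam0 b3.
have inv0 : (fun l : nat => lam ^- 2 * l.+1%:R^-1) @ \oo --> (0 : R).
  by rewrite -(mulr0 (lam ^- 2)); apply: cvgMr; exact: cvg_harmonic.
(* The shift leaves out l = 0, where the majorant 1 / (lambda^2 l) makes no sense. *)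
rewrite -(cvg_shiftS (fun l : nat => l%:R * b ^ (- Num.ceil (lam * l%:R)))).
apply: (squeeze_cvgr _ (cvg_cst 0) inv0); apply: nearW => l /=.
have b0 : 0 < b by lra.
have l0 : 0 < l.+1%:R :> R by [].
have x0 : 0 < lam * l.+1%:R by rewrite mulr_gt0.
rewrite mulr_ge0 ?(exprz_ge0 _ (ltW b0)) //=.
have := ceil_ge (lam * l.+1%:R); have := ceil_gt0 (lam * l.+1%:R).
rewrite x0; case: (Num.ceil _) => // k _; rewrite -exprnN -pmulrn => lek.
rewrite ler_pdivrMr ?exprn_gt0 // -mulrA ler_pdivlMl ?exprn_gt0 // ler_pdivlMl //.
apply: (@le_trans _ _ (k%:R ^+ 2)).
  by rewrite mulrCA -expr2 -exprMn lerXn2r ?nnegrE // ltW.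
apply: (@le_trans _ _ (3 ^+ k)); last by rewrite lerXn2r ?nnegrE; lra.
by rewrite -!natrX ler_nat sqr_le_exp3.
Qed.

(** * The bound as a closed-form formula *)

Lemma closed_form_piece_bound {R : realType} :
  closed_form (fun (lam : R) (r l m : nat) =>
    piece_bound m (l%:R * (2 * r%:R - 1) ^ (- Num.ceil (lam * l%:R)))).
Proof.
pose F_one := F_int 1.
exists (F_prod (F_int 0) (F_sub F_m F_one)
  (F_sub F_one (F_min F_one (F_mul (F_idx 0) (F_mul F_l
    (F_pow (F_sub (F_mul (F_int 2) F_r) F_one)
           (F_sub (F_int 0) (F_ceil (F_mul F_lambda F_l))))))))).
move=> lam r l m [_ r2 _ _] /=.
have range_m : range_size (0 : R) (m%:R - 1) = m.
  by rewrite /range_size subr0 subrK natrK.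
(* Positivity of the base makes the power with negative exponent defined. *)
have b0 : 0 < 2%:~R * r%:R - 1%:~R :> R.
  have : 2%:R <= r%:R :> R by rewrite ler_nat.
  by rewrite -!pmulrn; lra.
split.
  split=> //; first by rewrite rpredB // ?natr_int ?intr_int.
  move=> k _; split=> //; split=> //; split=> //; split=> //; split=> //.
  by rewrite /real_pow_defined b0.
rewrite range_m /piece_bound; apply: eq_bigr => i _.
congr (_ - Num.min _ (_ * (_ * _))).
  by rewrite add0r.
(* The exponent is an integer, so [real_pow] takes its integer-power branch. *)
by rewrite /real_pow sub0r -mulrNz intr_int intrKfloor.
Qed.

(** * Inversion, rotation and conjugacy of words *)

Section Words.
Context {X : finType}.
Implicit Types (u v w : seq (letter X)) (a b c : letter X).

Definition winv w : seq (letter X) := rev (map (@linv X) w).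

Lemma winvK : involutive winv.
Proof.
by move=> w; rewrite /winv map_rev revK -map_comp map_id_in // => a _; exact: linvK.
Qed.

Lemma winv_rot d w : winv (rot d w) = rotr d (winv w).
Proof. by rewrite /winv map_rot rev_rot. Qed.

Lemma size_winv w : size (winv w) = size w.
Proof. by rewrite size_rev size_map. Qed.

Lemma reduced_winv w : reduced (winv w) = reduced w.
Proof.
rewrite /reduced rev_sorted sorted_map; apply: eq_sorted => a b /=.
by rewrite linvK eq_sym.
Qed.

Lemma reduced_cycle w :
  cycle (fun a b => b != linv a) w -> cyclically_reduced w.
Proof.
move=> cw; apply/allP => d _; move: cw; rewrite -(rot_cycle d) /reduced.
by case: (rot d w) => //= a s; rewrite rcons_path => /andP[].
Qed.

(** No bound is put on [d]: rotating by the length or more is the identity, so nothing is added, and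
    symmetry and transitivity need no side conditions. *)
Definition conjugate u w : Prop :=
  exists d, u = rot d w \/ u = winv (rot d w).

Lemma rot_rot_ex d e w : exists f, rot d (rot e w) = rot f w.
Proof.
(* [rot_add_mod] asks for rotation distances not exceeding the length. *)
have red_rot n v : exists2 n', rot n v = rot n' v & (n' <= size v)%N.
  case: (leqP n (size v)) => [|/ltnW] nv; first by exists n.
  by exists (size v); rewrite // rot_size rot_oversize.
have [e' -> he] := red_rot e w; have [d' -> hd] := red_rot d (rot e' w).
by rewrite rot_add_mod //; [eexists | rewrite -(size_rot e' w)].
Qed.

Lemma rotr_ex d w : exists f, rotr d w = rot f w.
Proof. by eexists. Qed.

Lemma conjugate_sym {u w} : conjugate u w -> conjugate w u.
Proof.
case=> d [->|->]; last first.
  by exists d; right; rewrite winv_rot winvK rotK.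
by have [f fE] := rotr_ex d (rot d w); exists f; left; rewrite -fE rotK.
Qed.

Lemma conjugate_trans {v u w} : conjugate u v -> conjugate v w -> conjugate u w.
Proof.
case=> d uE [e vE].
have [f fE] := rot_rot_ex d e w.
(* Rotating an inverse to the left is inverting a rotation to the right. *)
have [g gE] : exists g, rot d (winv (rot e w)) = winv (rot g w).
  have [g' gE] := rot_rot_ex d (size (winv w) - e) (winv w).
  have [g gE'] : exists g, rot g' (winv w) = rotr g (winv w).
    (* A left rotation by g' is a right rotation by the complementary distance; if g' exceeds the
       length, both are the identity. *)
    exists (size w - g')%N; rewrite /rotr size_winv.
    case: (leqP g' (size w)) => h; first by rewrite subKn.
    by rewrite (eqP (ltnW h)) subn0 -size_winv rot_size rot_oversize // size_winv ltnW.
  by exists g; rewrite !winv_rot -gE' -gE.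
case: vE uE => -> [->|->].
- by exists f; left.
- by exists f; right; rewrite fE.
- by exists g; right.
- by exists g; left; rewrite gE winvK.
Qed.

End Words.

(** * Symmetric closures and their prefixes *)

Section SymmetricClosure.
Context {X : finType}.
Implicit Types (u v w : free_group X) (W : seq (free_group X)).

Lemma cyclic_shiftE d (w : free_group X) : cyclically_reduced w ->
  fg_word (cyclic_shift d w) = rot d w.
Proof.
move=> cw; apply: reduce_id.
case: (ltnP d (size w)) => dw; last by rewrite rot_oversize //; case: (w).
by move/allP: cw; apply; rewrite mem_iota.
Qed.

Lemma fg_word_inv (u : free_group X) : fg_word (u^-1)%g = winv u.
Proof. by apply: reduce_id; rewrite reduced_winv; case: u. Qed.

Lemma size_symmetric_closure l (W : seq (free_group X)) :
  {in W, forall w : free_group X, size w = l} ->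
  size (symmetric_closure W) = (2 * l * size W)%N.
Proof.
elim: W => [|w W IHW] Wl; first by rewrite muln0.
have Wl' : {in W, forall w : free_group X, size w = l}.
  by move=> v vW; apply: Wl; rewrite inE vW orbT.
rewrite /symmetric_closure /= size_cat [X in (_ + X)%N]IHW // mulnS; congr addn.
rewrite -(Wl w) ?mem_head // -[in RHS](size_iota 0 (size w)).
by elim: (iota _ _) => //= d s ->; rewrite mulnS.
Qed.

Lemma symmetric_closure_cons (w : free_group X) (W : seq (free_group X)) :
  symmetric_closure (w :: W) = symmetric_closure [:: w] ++ symmetric_closure W.
Proof. by rewrite /symmetric_closure /= cats0. Qed.

Definition cr_relators l (W : seq (free_group X)) : Prop :=
  {in W, forall w : free_group X, cyclically_reduced w /\ size w = l}.

Lemma mem_symmetric_closure {l} {W : seq (free_group X)} (u : free_group X) :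
  (0 < l)%N -> cr_relators l W ->
  u \in symmetric_closure W <-> exists2 w, w \in W & conjugate u w.
Proof.
move=> l0 crW; split.
  case/flatten_mapP => w wW /flatten_mapP[d _]; have [cw _] := crW w wW.
  rewrite !inE => /orP[]/eqP->; exists w => //; exists d.
    by left; rewrite cyclic_shiftE.
  by right; rewrite fg_word_inv cyclic_shiftE.
case=> w wW [d uE]; have [cw sw] := crW w wW.
(* The symmetric closure only ranges over d < |w|; a larger distance is replaced by 0, which is in
   range because l > 0. *)
wlog dl : d uE / (d < size w)%N => [hw|].
  case: (ltnP d (size w)) => dw; first exact: hw dw.
  apply: (hw 0%N); last by rewrite sw.
  by rewrite rot0 -(rot_oversize dw).
apply/flatten_mapP; exists w => //; apply/flatten_mapP; exists d.
  by rewrite mem_iota.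
have fg_inj : injective (@fg_word X) := val_inj.
rewrite !inE; case: uE => uE; apply/orP; [left|right]; apply/eqP/fg_inj.
  by rewrite uE cyclic_shiftE.
by rewrite uE fg_word_inv cyclic_shiftE.
Qed.

Lemma size_mem_symmetric_closure {l} {W : seq (free_group X)} (u : free_group X) :
  (0 < l)%N -> cr_relators l W -> u \in symmetric_closure W -> size u = l.
Proof.
move=> l0 crW /(mem_symmetric_closure u l0 crW)[w /crW[_ <-]].
by case=> d [->|->]; rewrite ?size_winv size_rot.
Qed.

(* A relator conjugate to another one could be dropped without changing the
   symmetric closure, against minimality. *)
Lemma uniq_symmetric_closure {l} {W : seq (free_group X)} :
  (0 < l)%N -> cr_relators l W -> minimal W ->
  (forall w : free_group X, w \in W -> power_free w) -> uniq (symmetric_closure W).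
Proof.
move=> l0; elim: W => [//|w W IHW] crwW minW pfW.
have crW : cr_relators l W by move=> v vW; apply: crwW; rewrite inE vW orbT.
have crw : cr_relators l [:: w].
  by move=> v; rewrite inE => /eqP->; apply: crwW; rewrite mem_head.
rewrite symmetric_closure_cons cat_uniq; apply/and3P; split.
(* Power-freeness says that removing duplicates leaves 2|w| elements, which is already the length of
   the list. *)
- rewrite -[uniq _]negbK -ltn_size_undup pfW ?mem_head //.
  rewrite (@size_symmetric_closure l) ?(crw w _).2 ?mem_head // ?muln1 ?ltnn //.
  by move=> v /crw[].
- apply/hasPn => x /(mem_symmetric_closure x l0 crW)[v vW xv]; apply/negP => /=.
  case/(mem_symmetric_closure x l0 crw) => w'; rewrite inE => /eqP-> xw.
  apply: (minW W); [exact: subseq_cons| |].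
    by move/(congr1 size)/eqP; rewrite /= ltn_eqF.
  move=> u; rewrite symmetric_closure_cons mem_cat.
  apply/idP/orP => [|[|//]]; first by right.
  case/(mem_symmetric_closure u l0 crw) => w''; rewrite inE => /eqP-> uw.
  apply/(mem_symmetric_closure u l0 crW); exists v => //.
  exact: conjugate_trans uw (conjugate_trans (conjugate_sym xw) xv).
(* Minimality passes to the tail: putting [w] back in front of a smaller [U] with the same closure
   contradicts minimality of the whole list. *)
- apply: IHW => // [U UW UneqW scU|v vW]; last by apply: pfW; rewrite inE vW orbT.
  apply: (minW (w :: U)); first by rewrite /= eqxx.
    by case.
  move=> u; rewrite (symmetric_closure_cons w U) (symmetric_closure_cons w W).
  rewrite !mem_cat; congr orb.
  exact: scU.
Qed.

(** Two distinct closure elements with a common prefix of length k factor without cancellation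
    through it, so C'(lambda) would give k < lambda l, against the choice of k. *)
Lemma uniq_pieces {R : realType} (lam : R) k l (W : seq (free_group X)) :
  (0 < l)%N -> cr_relators l W -> (k <= l)%N -> lam * l%:R <= k%:R ->
  metric_small_cancellation lam W ->
  uniq [seq take k (fg_word u) | u <- symmetric_closure W].
Proof.
move=> l0 crW kl lamk [minW pfW smallW].
rewrite map_inj_in_uniq; last first.
  move=> u v uW vW uv; apply/eqP/negP => /negP/eqP neq_uv.
  have take_red (x : free_group X) : reduced (take k x).
    by case: (x) => /= s; exact: take_sorted.
  have drop_red (x : free_group X) : reduced (drop k x).
    by case: (x) => /= s; exact: drop_sorted.
  have split_eq (x : free_group X) :
      x = (FreeGroup (take_red x) * FreeGroup (drop_red x))%g.
    apply: val_inj; rewrite -[RHS]/(reduce (_ ++ _)) /= cat_take_drop.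
    by rewrite reduce_id //; case: (x).
  have su := size_mem_symmetric_closure u l0 crW uW.
  have sv := size_mem_symmetric_closure v l0 crW vW.
  have := smallW u v uW vW neq_uv (FreeGroup (take_red u))
    (FreeGroup (drop_red u)) (FreeGroup (drop_red v)) (split_eq u).
  have -> : FreeGroup (take_red u) = FreeGroup (take_red v) by apply: val_inj.
  move=> /(_ (split_eq v)); rewrite /= -{1}uv -!size_cat !cat_take_drop.
  move=> /(_ erefl erefl); rewrite su sv minnn size_takel ?sv //.
  by rewrite ltNge lamk.
exact: uniq_symmetric_closure l0 crW minW pfW.
Qed.

End SymmetricClosure.

(** * Counting cyclically reduced words with a given prefix *)

Lemma card_tuple_cons {T : finType} n (P : pred (seq T)) :
  #|[pred t : n.+1.-tuple T | P t]| =
  (\sum_(a : T) #|[pred t : n.-tuple T | P (a :: t)]|)%N.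
Proof.
rewrite -sum1_card.
under [RHS]eq_bigr do rewrite -sum1_card.
rewrite pair_big_dep /=.
rewrite (reindex (fun p : T * n.-tuple T => [tuple of p.1 :: p.2])) /=.
  by apply: eq_bigl => -[a t].
exists (fun t : n.+1.-tuple T => (thead t, [tuple of behead t])).
  by move=> [a t] _; congr pair; apply: val_inj.
by move=> t _ /=; rewrite -tuple_eta.
Qed.

Lemma card_mem_preim {T : finType} {S : eqType} (f : T -> S) (s : seq S) :
  uniq s ->
  #|[pred x | f x \in s]| = (\sum_(p <- s) #|[pred x | f x == p]|)%N.
Proof.
move=> us; under eq_bigr do rewrite -sum1_card big_mkcond.
rewrite exchange_big /= -sum1_card big_mkcond; apply: eq_bigr => x _.
rewrite -big_mkcond sum1_count /= (eq_count (_ : _ =1 pred1 (f x))).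
  by rewrite count_uniq_mem // inE; case: (_ \in _).
by move=> p; rewrite inE /= eq_sym.
Qed.

Section Counting.
Context {X : finType}.
Let letter := letter X.
Let rk := #|X|.
Implicit Types (a b c : letter) (n k l : nat).

Local Notation step := (fun a b : letter => b != linv a).

Lemma card_step a : #|[pred b | step a b]| = (2 * rk).-1.
Proof. by rewrite -[LHS]/#|predC1 (linv a)| cardC1 card_prod card_bool mulnC. Qed.

Lemma card_path n a :
  #|[pred t : n.-tuple letter | path step a t]| = ((2 * rk).-1 ^ n)%N.
Proof.
elim: n a => [|n IHn] a.
  rewrite (@eq_card _ _ predT) ?card_tuple // => t.
  by rewrite [t]tuple0 !inE.
rewrite card_tuple_cons expnS -{1}(card_step a) -sum_nat_const big_mkcond /=.
rewrite [RHS]big_mkcond /=; apply: eq_bigr => b _; rewrite inE /=.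
by case: ifP => _; [exact: IHn|exact: eq_card0].
Qed.

(** The condition on the last letter later closes a word up cyclically. Every letter but the last
    has 2r - 1 choices; the last one has to avoid [c] and the inverse of its predecessor, which
    leaves at least 2r - 2. *)
Lemma card_path_last n a c :
  (((2 * rk).-2 * (2 * rk).-1 ^ n) <=
   #|[pred t : n.+1.-tuple letter | path step a t && (last a t != c)]|)%N.
Proof.
elim: n a => [|n IHn] a.
  rewrite expn0 muln1 (card_tuple_cons _ (fun t => path step a t && (last a t != c))).
  apply: (@leq_trans #|[predD1 (predC1 c) & linv a]|).
    have cardc : #|predC1 c| = (2 * rk).-1 by rewrite cardC1 card_prod card_bool mulnC.
    have := cardD1 (linv a) (predC1 c); rewrite cardc.
    by case: (_ \in _) => /(congr1 predn) -> //=; exact: leq_pred.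
  rewrite -sum1_card big_mkcond /=; apply: leq_sum => b _.
  case: ifP => // /andP[ab]; rewrite inE => bc.
  by apply/card_gt0P; exists [tuple]; rewrite -topredE /= ab bc.
rewrite (card_tuple_cons _ (fun t => path step a t && (last a t != c))).
rewrite expnS mulnCA -{1}(card_step a) -sum_nat_const big_mkcond /=.
by apply: leq_sum => b _; rewrite inE; case: ifP => _; [exact: IHn|].
Qed.

(** Prepending [p] is injective. Peeling off the letters of [p] one by one avoids casts between
    tuple lengths. *)
Lemma card_cons_prefix n (p : seq letter) (P : pred (seq letter)) :
  (#|[pred t : n.-tuple letter | P (p ++ t)]| <=
   #|[pred t : (size p + n).-tuple letter | P t && (take (size p) t == p)]|)%N.
Proof.
elim: p P => [|c p IHp] P.
  apply: subset_leq_card; apply/fintype.subsetP => t.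
  by rewrite !inE take0 eqxx andbT.
apply: (leq_trans (IHp (fun s => P (c :: s)))).
rewrite /= addSn (card_tuple_cons _ (fun t => P t && (take (size p).+1 t == c :: p))).
rewrite (bigD1 c) //=; apply: leq_trans (leq_addr _ _).
by apply: subset_leq_card; apply/fintype.subsetP => t; rewrite !inE /= eqseq_cons eqxx.
Qed.

Lemma card_cr_word_pred l (P : pred (seq letter)) :
  #|[pred w : cr_word X l | P (val (val w))]| =
  #|[pred t : l.-tuple letter | cyclically_reduced t && P t]|.
Proof.
rewrite -(card_imset _ val_inj) -(cardsE [pred t | _ t]); apply: eq_card => t.
rewrite inE; apply/imsetP/andP => [[w Pw ->]|[ct Pt]].
  by split; [exact: (valP w)|exact: Pw].
by exists (exist _ t ct).
Qed.

Lemma card_cr_word_le l :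
  (#|{: cr_word X l.+1}| <= 2 * rk * (2 * rk).-1 ^ l)%N.
Proof.
have -> : #|{: cr_word X l.+1}| = #|[pred w : cr_word X l.+1 | predT (val (val w))]|.
  exact: eq_card.
rewrite (card_cr_word_pred _ predT).
apply: (@leq_trans #|[pred t : l.+1.-tuple letter | reduced t]|).
  apply: subset_leq_card; apply/fintype.subsetP => t.
  by rewrite !inE andbT; exact: cyclically_reduced_reduced.
rewrite card_tuple_cons /=.
under eq_bigr do rewrite /reduced /= card_path.
by rewrite sum_nat_const card_prod card_bool [(#|_| * 2)%N]mulnC.
Qed.

Lemma card_cr_word_prefix_ge n c (p : seq letter) :
  reduced (c :: p) ->
  ((2 * rk).-2 * (2 * rk).-1 ^ n <=
   #|[pred w : cr_word X ((size p).+1 + n.+1) |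
       take (size p).+1 (val (val w)) == c :: p]|)%N.
Proof.
move=> rp; apply: leq_trans (card_path_last n (last c p) (linv c)) _.
rewrite (card_cr_word_pred _ (fun w => take (size p).+1 w == c :: p)).
apply: leq_trans (card_cons_prefix n.+1 (c :: p) (@cyclically_reduced X)).
apply: subset_leq_card; apply/fintype.subsetP => t /andP[pt lt].
(* The cyclic word is read as a closed path: from the end of [t] to [c], along [p], then along [t].
   The closing step is the condition on the last letter of [t], with the inverse moved to the other
   side. *)
apply: (reduced_cycle (c :: p ++ t)); rewrite (cycle_path c) /=.
rewrite last_cat cat_path pt andbT.
rewrite -[path _ _ p]/(reduced (c :: p)) rp andbT.
by rewrite eq_sym -(inj_eq (inv_inj (@linvK X))) linvK.
Qed.

(* A reduced prefix is completed to a cyclically reduced word with [2r-1]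
   choices for each further letter, except [2r-2] for the last one. *)
Lemma card_cr_word_prefix l (p : seq letter) :
  (2 <= rk)%N -> reduced p -> (0 < size p)%N -> (size p < l)%N || (l == 1) ->
  (size p <= l)%N ->
  (#|{: cr_word X l}| <= 2 * (2 * rk).-1 ^ size p *
    #|[pred w : cr_word X l | take (size p) (val (val w)) == p]|)%N.
Proof.
case: p => // c p rk2 rp _ /orP[pl|/eqP->] ple.
  have [n ->] : exists n, l = ((size p).+1 + n.+1)%N.
    by exists (l - (size p).+2)%N; rewrite addnS -addSn subnKC.
  apply: leq_trans (leq_mul (leqnn _) (card_cr_word_prefix_ge n c p rp)).
  rewrite addnS; apply: leq_trans (card_cr_word_le _) _; rewrite expnD.
  rewrite -[X in (2 * _ ^ X)%N]/(size p).+1 [leqRHS]mulnACA leq_mul2r.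
  (* What remains is 2r <= 2 (2r - 2), that is r >= 2; this is the source of the factor 2 in the
     statement. *)
  by apply/orP; right; lia.
(* Here the prefix is the whole word of length 1, and 2r <= 2 (2r - 1) suffices. *)
case: p rp ple => // _ _; rewrite [size _]/= expn1.
apply: leq_trans (card_cr_word_le 0) _.
rewrite (card_cr_word_pred 1 (fun w => take 1 w == [:: c])).
rewrite (@leq_trans (2 * (2 * rk).-1 * 1)) //; first by lia.
rewrite leq_mul2l; apply/orP; right; apply/card_gt0P; exists [tuple c].
by rewrite !inE /= eqxx.
Qed.

End Counting.

(** * Counting the lists whose prefixes are pairwise distinct *)

Section SmallCancellationCount.
Context {X : finType}.
Implicit Types (k l m : nat).

(** Prefixes are listed with multiplicity, so that [uniq] also expresses that no two closure
    elements share one. *)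
Definition pieces k l (W : seq (cr_word X l)) : seq (seq (letter X)) :=
  [seq take k (fg_word u) | u <- symmetric_closure (map (@relator X l) W)].
Arguments pieces k {l} W.

Lemma cr_relators_map {l} (W : seq (cr_word X l)) :
  cr_relators l (map (@relator X l) W).
Proof. by move=> _ /mapP[w _ ->]; split; [exact: (valP w)|exact: size_tuple]. Qed.

Lemma size_pieces k l (W : seq (cr_word X l)) :
  size (pieces k W) = (2 * l * size W)%N.
Proof.
rewrite size_map -(size_map (@relator X l)); apply: size_symmetric_closure.
by move=> u /cr_relators_map[].
Qed.

Lemma mem_pieces k l (W : seq (cr_word X l)) p :
  (0 < l)%N -> (k <= l)%N -> p \in pieces k W -> reduced p /\ size p = k.
Proof.
move=> l0 kl /mapP[u uW ->]; split.
  by case: (u) => s /=; exact: take_sorted.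
by rewrite size_takel // (size_mem_symmetric_closure u l0 (cr_relators_map W)).
Qed.

(** A relator lies in its own symmetric closure, so its prefix belongs to the first block of the
    list, which is disjoint from the rest. *)
Lemma uniq_pieces_cons k l (w : cr_word X l) W :
  (0 < l)%N -> uniq (pieces k (w :: W)) ->
  uniq (pieces k W) && (take k (val (val w)) \notin pieces k W).
Proof.
move=> l0; rewrite /pieces /= symmetric_closure_cons map_cat cat_uniq.
case/and3P => _ /hasPn disj ->; rewrite andTb; apply/negP => wW.
have := disj _ wW => /negP; apply.
have crw := cr_relators_map [:: w].
suff wsc : relator w \in symmetric_closure [:: relator w].
  by apply/mapP; exists (relator w).
apply/(mem_symmetric_closure _ l0 crw); exists (relator w); first exact: mem_head.
by exists 0%N; left; rewrite rot0.
Qed.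

Lemma card_uniq_pieces {R : realType} k l m :
  (2 <= #|X|)%N -> (0 < k <= l)%N -> (k < l)%N || (l == 1) ->
  #|[pred W : m.-tuple (cr_word X l) | uniq (pieces k W)]|%:R <=
  piece_bound m (l%:R * (2 * #|X|%:R - 1) ^- k) * #|{: cr_word X l}|%:R ^+ m :> R.
Proof.
move=> X2 /andP[k0 kl] kl1; have l0 := leq_trans k0 kl.
set N := #|{: cr_word X l}|; set x := l%:R * _ ^- k.
have q0 : 0 < 2 * #|X|%:R - 1 :> R.
  by have : 2%:R <= #|X|%:R :> R; [rewrite ler_nat | lra].
have qE : (2 * #|X|).-1%:R = 2 * #|X|%:R - 1 :> R.
  by rewrite -subn1 natrB ?natrM //; lia.
elim: m => [|m IHm].
  rewrite /piece_bound big_ord0 expr0 mul1r.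
  by rewrite -[leRHS]/(1%:R) ler_nat -(expn0 N) -card_tuple max_card.
rewrite (card_tuple_cons _ (fun W => uniq (pieces k W))).
pose good (W : m.-tuple (cr_word X l)) := uniq (pieces k W).
have avoid_le (W : m.-tuple (cr_word X l)) : good W ->
    #|[pred w : cr_word X l | take k (val (val w)) \notin pieces k W]|%:R <=
    N%:R * (1 - Num.min 1 (m%:R * x)) :> R.
  move=> gW; set f := fun w : cr_word X l => take k (val (val w)).
  have cardf := cardC [pred w | f w \in pieces k W].
  rewrite -[N]cardf.
  rewrite -[X in X%:R <= _]/#|[predC [pred w | f w \in pieces k W]]|.
  set B := #|[predC _]|; set A := #|[pred w | _]| in cardf *.
  (* The forbidden words split into 2lm classes, one for each prefix, of at least N / (2 (2r-1)^k)
     words each. The two factors 2 cancel, which is why the inequality is doubled first. *)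
  have A_ge : N%:R * (m%:R * x) <= A%:R :> R.
    rewrite /x mulrA mulrA ler_pdivrMr ?exprn_gt0 // -qE.
    rewrite -natrX -!natrM ler_nat /A card_mem_preim //.
    rewrite -(leq_pmul2r (isT : 0 < 2)%N).
    have -> : (N * m * l * 2 = \sum_(p <- pieces k W) N)%N.
      by rewrite big_const_seq count_predT iter_addn_0 size_pieces size_tuple; lia.
    rewrite -mulnA mulnC big_distrr /= [leqLHS]big_seq [leqRHS]big_seq.
    apply: leq_sum => p pW.
    have [rp sp] := mem_pieces k l W p l0 kl pW.
    have := card_cr_word_prefix l p X2 rp; rewrite sp [(_ ^ k * 2)%N]mulnC.
    exact.
  have : N%:R * Num.min 1 (m%:R * x) <= N%:R * (m%:R * x).
    by rewrite ler_wpM2l // ge_min lexx orbT.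
  by rewrite cardf mulrBr mulr1 -/N -[N in N%:R - _]cardf natrD; lra.
(* Exchanging the sums fixes the m old relators first, so that [avoid_le] bounds the choices for the
   new one. *)
have count_le : (\sum_(w : cr_word X l)
      #|[pred W : m.-tuple (cr_word X l) | uniq (pieces k (w :: W))]| <=
    \sum_(W | good W)
      #|[pred w : cr_word X l | take k (val (val w)) \notin pieces k W]|)%N.
  under [leqRHS]eq_bigr do rewrite -sum1_card big_mkcond.
  rewrite exchange_big; apply: leq_sum => w _.
  rewrite -sum1_card [leqLHS]big_mkcond [leqRHS]big_mkcond; apply: leq_sum => W _.
  rewrite inE; case: ifP => // /(uniq_pieces_cons _ _ _ _ l0)/andP[gW wW].
  by rewrite /good gW inE wW.
apply: (@le_trans _ _ _ _ _ (_ : _ <= _%:R)); first by rewrite ler_nat; exact: count_le.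
rewrite natr_sum; apply: le_trans (ler_sum _ avoid_le) _.
rewrite sumr_const -[leLHS]mulr_natl piece_boundS exprSr [leRHS]mulrACA.
by rewrite [X in _ <= _ * X]mulrC ler_wpM2r // mulr_ge0 // subr_ge0 ge_min lexx.
Qed.

Lemma pr_small_cancellation_le {R : realType} (lam : R) k l m :
  (2 <= #|X|)%N -> (0 < k <= l)%N -> (k < l)%N || (l == 1) ->
  lam * l%:R <= k%:R ->
  pr_small_cancellation X lam l m <=
  piece_bound m (l%:R * (2 * #|X|%:R - 1) ^- k).
Proof.
move=> X2 /andP[k0 kl] kl1 lamk; have l0 := leq_trans k0 kl.
rewrite /pr_small_cancellation /uniform_pr card_tuple.
(* Over an empty sample space the quotient is 0, by the convention for division by zero. *)
have [->|N0] := eqVneq (#|{: cr_word X l}| ^ m)%N 0%N.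
  by rewrite invr0 mulr0 piece_bound_ge0.
rewrite ler_pdivrMr ?ltr0n ?lt0n // natrX.
apply: le_trans (card_uniq_pieces k l m X2 _ kl1); last by rewrite k0.
rewrite ler_nat; apply: subset_leq_card; apply/fintype.subsetP => W.
move=> /asboolP[_ scW].
exact: uniq_pieces lam k l _ l0 (cr_relators_map W) kl lamk scW.
Qed.

End SmallCancellationCount.

(** * Assembly of the three claims *)

Theorem theorem1p2 (R : realType) :
  exists p : R -> nat -> nat -> nat -> R,
    [/\ closed_form p
        /\ (forall (lam : R) (r l m : nat), admissible lam r l m ->
              0 <= p lam r l m),
        (forall (lam : R) (r l m : nat), admissible lam r l m ->
           forall X : finType, #|X| = r ->
             pr_small_cancellation X lam l m <= p lam r l m),
        (forall (lam : R) (r l m : nat), admissible lam r l m ->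
           ((1 / 8 * (m%:R - 1) ^+ 2 * l%:R
             * (2 * r%:R - 1) ^ (- Num.ceil (lam * l%:R)))%:E
            <= lne ((p lam r l m)%:E^-1))%E)
      & (forall (lam : R) (r m : nat),
           0 < lam <= 1 / 6 -> (2 <= r)%N -> (1 <= m)%N ->
           (fun l : nat => p lam r l m) @ \oo --> (1 : R)
           /\ (fun l : nat => lne ((p lam r l m)%:E^-1)%E) @ \oo --> 0%E)].
Proof.
have base_ge3 r : (2 <= r)%N -> 3 <= 2 * r%:R - 1 :> R.
  by rewrite -(ler_nat R); lra.
exists (fun lam r l m =>
  piece_bound m (l%:R * (2 * r%:R - 1) ^ (- Num.ceil (lam * l%:R)))).
split.
- by split=> [|lam r l m _]; [exact: closed_form_piece_bound|exact: piece_bound_ge0].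
- move=> lam r l m [/andP[lam0 lam6] r2 l1 _] X Xr.
  have l0 : 0 < l%:R :> R by rewrite ltr0n.
  have := ceil_gt0 (lam * l%:R); rewrite mulr_gt0 //.
  have := ceil_ge (lam * l%:R); have := ceilB1_lt (lam * l%:R).
  (* The ceiling is positive, hence a natural number k with k - 1 < lambda l <= k. *)
  case: (Num.ceil _) => // k; rewrite intrB -!pmulrn => ltk lek k0.
  rewrite -exprnN -Xr; apply: pr_small_cancellation_le => //; first by rewrite Xr.
    rewrite -ltz_nat k0 /= -ltnS -(ltr_nat R) -natr1; nra.
  (* Since lambda <= 1/6, k < l/6 + 1 <= l as soon as l >= 2; for l = 1 the prefix is the whole
     relator. *)
  case: (ltnP 1 l) => l2; last by apply/orP; right; rewrite eqn_leq l2.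
  have : 2 <= l%:R :> R by rewrite (ler_nat R 2).
  by move=> l2R; rewrite -(ltr_nat R); apply/orP; left; nra.
- move=> lam r l m [_ /base_ge3 r3 _ m1].
  have x0 : 0 <= l%:R * (2 * r%:R - 1) ^ (- Num.ceil (lam * l%:R)) :> R.
    by rewrite mulr_ge0 // exprz_ge0 //; lra.
  have m1R : 1 <= m%:R :> R by rewrite ler1n.
  apply: le_trans (lne_inve_ge _ _ (piece_bound_ge0 m _) (piece_bound_le_expR m _ x0)).
  (* For m >= 1, (m - 1)^2 / 8 <= m (m - 1) / 2. *)
  rewrite lee_fin -mulrA ler_wpM2r //; nra.
move=> lam r m /andP[lam0 _] /base_ge3 r3 _.
set p := fun l : nat => piece_bound m _.
suff p1 : p @ \oo --> (1 : R) by split=> //; exact: cvg_lne_inve.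
have x0 := cvg_mul_expr_ceil lam _ lam0 r3.
have low : (fun l : nat => 1 - m%:R ^+ 2 *
    (l%:R * (2 * r%:R - 1) ^ (- Num.ceil (lam * l%:R)))) @ \oo --> (1 : R).
  rewrite -[1 in X in _ --> X]subr0 -(mulr0 (m%:R ^+ 2)).
  by apply: cvgB; [exact: cvg_cst|exact: cvgMr].
have high : (fun=> 1 : R) @ \oo --> (1 : R) by exact: cvg_cst.
refine (squeeze_cvgr _ low high); apply: nearW => l /=.
have xl0 : 0 <= l%:R * (2 * r%:R - 1) ^ (- Num.ceil (lam * l%:R)) :> R.
  by rewrite mulr_ge0 // exprz_ge0 //; lra.
by rewrite piece_bound_ge //= piece_bound_le1.
Qed.
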